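(* Let $1\le\kappa<6/5$ and put $\gamma(\kappa)=\frac{3}{\kappa}-\frac52$. Assume the $abc$ inequality with exponent $\kappa$ for all coprime triples. Then, for every $\delta\in(0,\gamma(\kappa))$, only finitely many solutions $(x,y,k)$ of $y^2=x^3+k$ (primitive or not) satisfy $|k|<x^{\gamma(\kappa)-\delta}$. For $\kappa=1$, the $abc$ conjecture implies the weak Hall conjecture in full, that is: for every $\delta>0$, there are only finitely many solutions $(x,y,k)$ with $0<|k|<x^{1/2-\delta}$.
   Context: A solution is a triple $(x,y,k)$ of integers with $y^2=x^3+k$, $x\ge 1$, $y\ge 1$ and $k\ne 0$. It is primitive when $\gcd(x,y)=1$. A coprime triple is an (unordered) triple of coprime positive integers one of which is the sum of the other two. Its quality is $\frac{\log m}{\log r}$, where $m$ is its largest term and $r$ is the radical (the product of the distinct prime divisors) of the product of its three terms. For $\kappa\ge 1$, the $abc$ inequality with exponent $\kappa$ is said to hold for a set of coprime triples when, for every $\varepsilon>0$, only finitely many triples in the set have quality above $\kappa+\varepsilon$. The $abc$ conjecture is the $abc$ inequality with exponent $1$ for the set of all coprime triples. *)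

(* Defs.v *)
From HB Require Import structures.
From mathcomp Require Import all_boot all_order all_algebra.
From mathcomp Require Import all_classical all_reals all_analysis.

Set Implicit Arguments.
Unset Strict Implicit.
Unset Printing Implicit Defensive.

Import Order.TTheory GRing.Theory Num.Theory.
Local Open Scope classical_set_scope.
Local Open Scope ring_scope.

Definition rad (n : nat) : nat := (\prod_(p <- primes n) p)%N.

(* An unordered triple of naturals is represented by its nondecreasing
   listing [(a, b, c)], so that each unordered triple occurs exactly once. *)
Definition coprime_triple : set (nat * nat * nat) :=
  [set t | let: (a, b, c) := t in
    [/\ (a <= b <= c)%N,
        [/\ (0 < a)%N, (0 < b)%N & (0 < c)%N],
        gcdn (gcdn a b) c = 1%N
      & [\/ a = (b + c)%N, b = (a + c)%N | c = (a + b)%N]]].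

Definition quality (R : realType) (t : nat * nat * nat) : R :=
  let: (a, b, c) := t in
  ln (maxn (maxn a b) c)%:R / ln (rad (a * b * c)%N)%:R.

(* Only meant for [1 <= kappa] and [S `<=` coprime_triple]. *)
Definition abc_inequality (R : realType) (kappa : R)
    (S : set (nat * nat * nat)) : Prop :=
  forall eps : R, 0 < eps ->
    finite_set [set t | S t /\ kappa + eps < quality R t].

Definition abc_conjecture (R : realType) : Prop :=
  abc_inequality (1 : R) coprime_triple.

(* Triples [(x, y, k)]. *)
Definition solution : set (int * int * int) :=
  [set s | let: (x, y, k) := s in
    [/\ y ^+ 2 = x ^+ 3 + k, 1 <= x, 1 <= y & k != 0]].

Definition gamma (R : realType) (kappa : R) : R := 3 / kappa - 5 / 2.

Definition weak_hall_conjecture (R : realType) : Prop :=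
  forall delta : R, 0 < delta ->
    finite_set [set s | solution s /\
      let: (x, y, k) := s in
      0 < `|k| /\ (`|k|%:~R : R) < (x%:~R : R) `^ (1 / 2 - delta)].

(* Main.v *)
Require Import Defs.
From mathcomp Require Import all_boot all_order all_algebra.
From mathcomp Require Import all_classical all_reals all_analysis.
From mathcomp Require Import ring lra zify.

Import Order.TTheory GRing.Theory Num.Theory.
Local Open Scope classical_set_scope.
Local Open Scope ring_scope.

(* Divide y^2 = x^3 + k by D = gcd(x^3, y^2), which gives the coprime triple
   a = x^3/D, b = y^2/D, c = |k|/D.  Every prime dividing abc divides
   xy|k|/D, so the abc inequality gives x^3/D <= (xy|k|/D)^kappa' for all but
   finitely many triples, kappa' being slightly above kappa.  As kappa' >= 1,
   the D on the right more than compensates the one on the left, so imprimitive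
   solutions satisfy x^3 <= (xy|k|)^kappa' as primitive ones do.  With
   y = O(x^(3/2)) this bounds x once |k| < x^(gamma - delta). *)

Lemma rad_gt0 (n : nat) : (0 < Defs.rad n)%N.
Proof.
rewrite /Defs.rad big_seq; apply: prodn_cond_gt0 => p.
by rewrite mem_primes => /andP[/prime_gt0].
Qed.

Lemma rad_gt1 (n : nat) : (1 < n)%N -> (1 < Defs.rad n)%N.
Proof.
move=> n1; apply: leq_trans (prime_gt1 (pdiv_prime n1)) _.
apply: dvdn_leq; first exact: rad_gt0.
rewrite /Defs.rad (bigD1_seq (pdiv n)) /= ?primes_uniq ?dvdn_mulr //.
by rewrite mem_primes pdiv_prime // pdiv_dvd ltnW.
Qed.

Lemma prod_primes_dvdn (s : seq nat) (t : nat) :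
  uniq s -> all prime s -> all (dvdn^~ t) s -> (\prod_(p <- s) p %| t)%N.
Proof.
elim: s => [|p s IHs] /=; first by rewrite big_nil dvd1n.
case/andP=> ps us /andP[pp pr_s] /andP[pt dv_s].
rewrite big_cons Gauss_dvd ?pt ?IHs //.
rewrite prime_coprime // Euclid_dvd_prod // big_has.
apply/hasPn => q qs /=; rewrite dvdn_prime2 //; last exact: (allP pr_s).
by apply: contraNneq ps => ->.
Qed.

(** Only the primes of [n] matter, so [t] need not be a multiple of [n]: this is what discards the
    exponents in [m ^ 3] and [n ^ 2] later. *)
Lemma rad_leq (n t : nat) : (0 < t)%N ->
  (forall p, prime p -> p %| n -> p %| t)%N -> (Defs.rad n <= t)%N.
Proof.
move=> t0 nt; apply: dvdn_leq => //; apply: prod_primes_dvdn.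
- exact: primes_uniq.
- by apply/allP => p; rewrite mem_primes => /andP[].
- by apply/allP => p; rewrite mem_primes => /and3P[pp _ /nt]; apply.
Qed.

(** The exceptional triples are finitely many, so [M] can be their greatest last entry; a triple
    with a larger sum is not exceptional. *)
Lemma abc_height_bound {R : realType} {kappa eps : R} :
  abc_inequality kappa coprime_triple -> 0 < eps ->
  exists M : nat, forall u v : nat, (0 < u)%N -> (0 < v)%N -> coprime u v ->
    (M < u + v)%N ->
    ln (u + v)%:R <= (kappa + eps) * ln (Defs.rad (u * v * (u + v)))%:R.
Proof.
move=> abc eps0; have /finite_seqP[s sE] := abc _ eps0.
exists (\max_(t <- s) t.2)%N => u v.
(* [coprime_triple] holds only nondecreasing listings, so the summands are ordered first. *)
wlog uv : u v / (u <= v)%N => [H u0 v0 cuv|u0 v0 cuv].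
  case/orP: (leq_total u v) => [|vu]; first by move/H; apply.
  by rewrite addnC (mulnC u); apply: H; rewrite // coprime_sym.
rewrite ltnNge => /negP H; rewrite leNgt; apply/negP => q; apply: H.
suff: (u, v, (u + v)%N) \in s.
  by move=> ts; apply: (leq_bigmax_seq _ ts).
suff: [set` s] (u, v, (u + v)%N) by [].
rewrite -sE /=; split.
  split; [by rewrite uv leq_addl|by rewrite addn_gt0 u0| |by constructor 3].
  by move/eqP: cuv => ->; rewrite gcd1n.
rewrite (maxn_idPr uv) (maxn_idPr (leq_addl u v)).
(* The denominator of the quality is positive since [u * v * (u + v)] is at least 2. *)
rewrite ltr_pdivlMr //; apply: ln_gt0; rewrite ltr1n rad_gt1 //; nia.
Qed.

(** The radical is at most [m * n * c]. Here [c] is not enlarged to [j]: writing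
    [ln a = 3 ln m - ln D] and [ln c = ln j - ln D] leaves a surplus [(kappa - 1) ln D], which is
    nonnegative. *)
Lemma ln_height_bound {R : realType} {kappa : R} {m n j D a b c : nat} :
  1 <= kappa -> (0 < m)%N -> (0 < n)%N -> (0 < j)%N ->
  (a * D = m ^ 3)%N -> (b * D = n ^ 2)%N -> (c * D = j)%N ->
  ln a%:R <= kappa * ln (Defs.rad (a * b * c))%:R ->
  3 * ln m%:R <= kappa * (ln m%:R + ln n%:R + ln j%:R).
Proof.
move=> k1 m0 n0 j0 aD bD cD H.
have [c0 D0] : (0 < c)%N /\ (0 < D)%N by split; nia.
have a0 : (0 < a)%N.
  by move: (expn_gt0 m 3); rewrite m0 -aD muln_gt0 => /andP[].
have rad_le : (Defs.rad (a * b * c) <= m * n * c)%N.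
  apply: rad_leq => [|p pp]; first by rewrite !muln_gt0 m0 n0.
  rewrite !Euclid_dvdM //; case/orP => [/orP[pa|pb]|->]; last by rewrite orbT.
    by move: (dvdn_mulr D pa); rewrite aD Euclid_dvdX // andbT => ->.
  by move: (dvdn_mulr D pb); rewrite bD Euclid_dvdX // andbT => ->; rewrite orbT.
have pos (i : nat) : (0 < i)%N -> i%:R \is @Num.pos R.
  by move=> i0; rewrite posrE ltr0n.
have lnr : ln (Defs.rad (a * b * c))%:R <= ln m%:R + ln n%:R + ln c%:R :> R.
  rewrite -!lnM ?pos -?natrM ?pos ?muln_gt0 ?m0 ?n0 // ler_ln ?pos ?ler_nat //.
    exact: rad_gt0.
  by rewrite !muln_gt0 m0 n0.
have lnj : ln j%:R = ln c%:R + ln D%:R :> R by rewrite -cD natrM lnM ?pos.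
have lna : 3 * ln m%:R = ln a%:R + ln D%:R :> R.
  by rewrite -lnM ?pos // -natrM aD natrX lnXn ?ltr0n // mulr_natl.
have lnD : 0 <= ln D%:R :> R by rewrite ln_ge0 // ler1n.
have := ler_wpM2l (le_trans ler01 k1) lnr.
have : 0 <= (kappa - 1) * ln D%:R by rewrite mulr_ge0 // subr_ge0.
by rewrite lna lnj; lra.
Qed.

(** Once [n] and [j] are bounded by powers of [m], the height bound is linear in [ln m], with slope
    below 3 on the right against 3 on the left. The disjunction is the sign of [k]. *)
Lemma solution_bound {R : realType} {kappa delta : R} :
  1 <= kappa -> 0 < delta -> abc_inequality kappa coprime_triple ->
  exists N : nat, forall m n j : nat, (0 < m)%N -> (0 < n)%N -> (0 < j)%N ->
    (n ^ 2 = m ^ 3 + j \/ m ^ 3 = n ^ 2 + j)%N ->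
    j%:R < m%:R `^ (gamma kappa - delta) -> (m <= N)%N /\ (n <= N)%N.
Proof.
move=> k1 d0 abc.
have kgt0 : 0 < kappa by lra.
(* With this excess over [kappa], the loss [(delta / 6) * (3 / kappa)] is at most [delta / 2], half
   of the gain [kappa * delta] or less. *)
have d60 : 0 < delta / 6 by lra.
have [M HM] := abc_height_bound abc d60.
set kp := kappa + delta / 6 in HM.
have kp1 : 1 <= kp by rewrite /kp; lra.
set B := Num.bound (expR (kp * ln 2 / delta)).
(* [M] bounds [m] when the triple may be exceptional, [B] otherwise; then [n <= n ^ 2 <= m ^ 3 + j]
   with [j < m]. *)
set A := (M + B)%N; exists (A ^ 3 + A)%N => m n j m0 n0 j0 mnj jlt.
have g12 : gamma kappa <= 1 / 2.
  have : 3 / kappa <= 3 by rewrite ler_pdivrMr //; lra.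
  by rewrite /gamma; lra.
have jm : (j < m)%N.
  rewrite -(ltr_nat R); apply: lt_le_trans jlt _.
  rewrite -[leRHS]powRr1 ?ler0n // ler_powR ?ler1n //; lra.
suff mA : (m <= A)%N.
  split; first exact: leq_trans mA (leq_addl _ _).
  have mA3 : (m ^ 3 <= A ^ 3)%N by rewrite leq_exp2r.
  have nn : (n <= n ^ 2)%N by rewrite leq_pmull.
  by case: mnj; lia.
set D := gcdn (m ^ 3) (n ^ 2).
have D0 : (0 < D)%N by rewrite gcdn_gt0 expn_gt0 m0.
have Dm : (D %| m ^ 3)%N := dvdn_gcdl _ _.
have Dn : (D %| n ^ 2)%N := dvdn_gcdr _ _.
have Dj : (D %| j)%N.
  case: mnj => E; first by rewrite -(dvdn_addr _ Dm) -E.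
  by rewrite -(dvdn_addr _ Dn) -E.
have /esym aD := divnK Dm; have /esym bD := divnK Dn; have /esym cD := divnK Dj.
set a := (m ^ 3 %/ D)%N in aD; set b := (n ^ 2 %/ D)%N in bD.
set c := (j %/ D)%N in cD.
have m30 : (0 < m ^ 3)%N by rewrite expn_gt0 m0.
have n20 : (0 < n ^ 2)%N by rewrite expn_gt0 n0.
have a0 : (0 < a)%N by move: m30; rewrite aD muln_gt0 => /andP[].
have b0 : (0 < b)%N by move: n20; rewrite bD muln_gt0 => /andP[].
have c0 : (0 < c)%N by move: j0; rewrite cD muln_gt0 => /andP[].
have cab : gcdn a b = 1%N.
  by apply/eqP; rewrite -(eqn_pmul2r D0) muln_gcdl -aD -bD mul1n.
(* The largest term is [b] or [a] according to the sign of [k]; it is at least [a] in both cases. *)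
have : (a <= M)%N \/ ln a%:R <= kp * ln (Defs.rad (a * b * c))%:R.
  have [aM|aM] := leqP a M; [by left|right].
  case: mnj => E.
    have Eb : b = (a + c)%N.
      by apply/eqP; rewrite -(eqn_pmul2r D0) mulnDl -aD -bD -cD E.
    have cop : coprime a c by rewrite /coprime -(gcdnDl a) -Eb cab.
    have := HM a c a0 c0 cop (leq_trans aM (leq_addr _ _)).
    rewrite -Eb mulnAC; apply: le_trans.
    by rewrite ler_ln ?posrE ?ltr0n // ler_nat Eb leq_addr.
  have Ea : a = (b + c)%N.
    by apply/eqP; rewrite -(eqn_pmul2r D0) mulnDl -aD -bD -cD E.
  have cop : coprime b c by rewrite /coprime -(gcdnDl b) -Ea gcdnC cab.
  have := HM b c b0 c0 cop; rewrite -Ea => /(_ aM).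
  by rewrite mulnC mulnA.
case=> [aM|lna].
  (* The fixed triple bounds [x] too: [x ^ 3 = a * D <= M * |k| <= M * x]. *)
  have m3 : (m ^ 3 <= M * m)%N.
    rewrite aD leq_mul // (leq_trans _ (ltnW jm)) //.
    by rewrite [leqRHS]cD leq_pmull.
  rewrite /A; nia.
have pos (i : nat) : (0 < i)%N -> i%:R \is @Num.pos R.
  by move=> i0; rewrite posrE ltr0n.
have h :=
  ln_height_bound kp1 m0 n0 j0 (esym aD) (esym bD) (esym cD) lna.
have lnj : ln j%:R <= (gamma kappa - delta) * ln m%:R.
  by rewrite -ln_powR ler_ln ?pos ?posrE ?powR_gt0 ?ltr0n // ltW.
(* This is [n ^ 2 <= 2 * m ^ 3], from [j < m]. *)
have lnn : 2 * ln n%:R <= ln 2 + 3 * ln m%:R :> R.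
  rewrite !mulr_natl -!lnXn ?ltr0n // -lnM ?posrE ?exprn_gt0 ?ltr0n //.
  rewrite -!natrX -natrM ler_ln ?pos ?muln_gt0 ?expn_gt0 ?m0 ?n0 // ler_nat; nia.
have X0 : 0 <= ln m%:R :> R by rewrite ln_ge0 // ler1n.
have L0 : 0 <= ln 2 :> R by rewrite ln_ge0 // ler1n.
(* The coefficients 1 of [m] and 3/2 of [n] cancel the 5/2 in [gamma]. *)
have sum_le :
  ln m%:R + ln n%:R + ln j%:R <= (3 / kappa - delta) * ln m%:R + ln 2 / 2.
  by move: lnj; rewrite /gamma; lra.
have coef : kp * (3 / kappa - delta) <= 3 - delta / 2.
  have -> : kp * (3 / kappa - delta)
      = 3 + (delta / 2) / kappa - kappa * delta - delta ^+ 2 / 6.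
    by rewrite /kp; field; rewrite gt_eqF.
  have kd : delta <= kappa * delta by rewrite ler_peMl // ltW.
  have : (delta / 2) / kappa <= delta / 2 by rewrite ler_pdivrMr //; lra.
  have := sqr_ge0 delta; lra.
have lnm : ln m%:R <= kp * ln 2 / delta.
  rewrite ler_pdivlMr //.
  have := ler_wpM2l (le_trans ler01 kp1) sum_le.
  have := ler_wpM2r X0 coef.
  lra.
have : m%:R <= expR (kp * ln 2 / delta) by rewrite -[leLHS]lnK ?pos // ler_expR.
move=> /le_lt_trans /(_ (archi_boundP (expR_ge0 _))).
by rewrite ltr_nat => /ltnW mB; apply: leq_trans mB (leq_addl _ _).
Qed.

(** As [k] is determined by [x] and [y], the solutions lie in the image of a finite box. *)
Lemma finite_solutions {R : realType} {kappa delta : R} :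
  1 <= kappa -> 0 < delta -> abc_inequality kappa coprime_triple ->
  finite_set [set s | solution s /\
    let: (x, y, k) := s in
    (`|k|%:~R : R) < (x%:~R : R) `^ (gamma kappa - delta)].
Proof.
move=> k1 d0 abc; have [N HN] := solution_bound k1 d0 abc.
pose f (p : 'I_N.+1 * 'I_N.+1) : int * int * int :=
  (p.1%:Z, p.2%:Z, p.2%:Z ^+ 2 - p.1%:Z ^+ 3).
apply: (@sub_finite_set _ _ (range f)); last exact/finite_image/finite_finset.
move=> [[x y] k] /= [[E x1 y1 k0]].
case: x x1 E => // m m0; case: y y1 => // n n0 E jlt.
have mnj : (n ^ 2 = m ^ 3 + `|k| \/ m ^ 3 = n ^ 2 + `|k|)%N by lia.
have j0 : (0 < `|k|)%N by lia.
have jlt' : `|k|%N%:R < (m%:R : R) `^ (gamma kappa - delta).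
  by move: jlt; rewrite -abszE.
have [mN nN] := HN m n `|k|%N m0 n0 j0 mnj jlt'.
exists (inord m, inord n) => //.
by rewrite /f /= !inordK ?ltnS // E addrC addKr.
Qed.

Theorem mainTheorem4 (R : realType) :
  (forall kappa : R, 1 <= kappa -> kappa < 6 / 5 ->
     abc_inequality kappa coprime_triple ->
     forall delta : R, 0 < delta -> delta < gamma kappa ->
       finite_set [set s | solution s /\
         let: (x, y, k) := s in
         (`|k|%:~R : R) < (x%:~R : R) `^ (gamma kappa - delta)])
  /\ (abc_conjecture R -> weak_hall_conjecture R).
Proof.
split=> [kappa k1 _ abc delta d0 _|abc delta d0]; first exact: finite_solutions.
apply: sub_finite_set (finite_solutions (lexx 1) d0 abc) => -[[x y] k] /=.
have -> : gamma (1 : R) = 1 / 2 by rewrite /gamma; field.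
by case=> ? [].
Qed.
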